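(* Let $$\mathcal{A}=\begin{bmatrix}\alpha I_n\otimes I_m & \mathcal{T}^{\top}\\ \mathcal{T} & -\alpha I_n\otimes I_m\end{bmatrix}\in\mathbb{R}^{2mn\times 2mn},\qquad \mathcal{T}=B_n\otimes I_m+\tau I_n\otimes(-L_m),$$ $$\mathcal{P}_{MS}=\begin{bmatrix}\sqrt{S_n^{*}S_n+\alpha^2 I_n}\otimes I_m+\tau I_n\otimes(-L_m) & \\ & \sqrt{S_nS_n^{*}+\alpha^2 I_n}\otimes I_m+\tau I_n\otimes(-L_m)\end{bmatrix}\in\mathbb{C}^{2mn\times 2mn}.$$ Then the eigenvalues of $\mathcal{P}_{MS}^{-1}\mathcal{A}$ are contained in $[-\sqrt2,-\tfrac{1}{\sqrt2}]\cup[\tfrac{1}{\sqrt2},\sqrt2]$, with the exception of a number of outliers bounded independently of $n$; that is, there is a constant $N(m)$ depending only on $m$ such that at most $N(m)$ eigenvalues of $\mathcal{P}_{MS}^{-1}\mathcal{A}$ (counted with multiplicity) lie outside this set.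
   Context: Let $n\ge 2$ and $m\ge 1$ be integers, $\tau>0$, $\gamma>0$, $\alpha=\tau/\sqrt{\gamma}$, $\theta\in[\tfrac12,1]$, and $\omega=e^{\mathbf{i}\zeta}$ with $\zeta\in[0,2\pi)$. $I_k$ is the $k\times k$ identity matrix, $\otimes$ is the Kronecker product, and $^{*}$ is the conjugate transpose. $-L_m\in\mathbb{R}^{m\times m}$ is a symmetric positive semi-definite matrix (the discretization matrix of the negative Laplacian). Square roots of Hermitian positive semi-definite matrices are the unique Hermitian positive semi-definite square roots. $B_n=B_n^{(1)}(B_n^{(2)})^{-1}$, where $B_n^{(1)}$ is the $n\times n$ lower bidiagonal matrix with $1$ on the diagonal, $-1$ on the first subdiagonal and zeros elsewhere, and $B_n^{(2)}$ is the $n\times n$ lower bidiagonal matrix with $\theta$ on the diagonal, $1-\theta$ on the first subdiagonal and zeros elsewhere. $S_n=S_n^{(1)}(S_n^{(2)})^{-1}$, where $S_n^{(1)}=B_n^{(1)}-\omega\, e_1e_n^{\top}$ and $S_n^{(2)}=B_n^{(2)}+\omega(1-\theta)\,e_1e_n^{\top}$, i.e. they coincide with $B_n^{(1)}$, $B_n^{(2)}$ except for the top-right corner entry, which is $-\omega$ and $\omega(1-\theta)$ respectively (here $e_j$ is the $j$-th standard basis vector of $\mathbb{R}^n$). It is assumed throughout that $S_n^{(2)}$ is nonsingular. *)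

(* Defs.v *)
From mathcomp Require Import all_boot all_order all_algebra.
From mathcomp Require Import all_classical all_reals all_analysis.
From mathcomp Require Import complex mxtens.

Set Implicit Arguments.
Unset Strict Implicit.
Unset Printing Implicit Defensive.

Import Order.TTheory GRing.Theory Num.Theory.
Local Open Scope ring_scope.
Local Open Scope complex_scope.
Local Open Scope sesquilinear_scope.

Notation cmx := (map_mx (real_complex _)).

Definition real_spsd (R : realType) (k : nat) (A : 'M[R]_k) : Prop :=
  A \is symmetricmx /\ forall x : 'cV[R]_k, 0 <= (x^T *m A *m x) 0 0.

(* In the order of R[i], [0 <= z] means that z is real and nonnegative. *)
Definition hpsd (R : realType) (k : nat) (A : 'M[R[i]]_k) : Prop :=
  A \is hermsymmx /\ forall x : 'cV[R[i]]_k, 0 <= (x^t* *m A *m x) 0 0.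

Definition hpsd_root (R : realType) (k : nat) (A X : 'M[R[i]]_k) : Prop :=
  hpsd X /\ X *m X = A.

(* The square root is unique by [hpsd_root_uniq] and exists by [sqrtmxP], so the
   default value 0 is never used when A is Hermitian positive semi-definite. *)
Definition sqrtmx (R : realType) (k : nat) (A : 'M[R[i]]_k) : 'M[R[i]]_k :=
  xget 0 [set X | hpsd_root A X]%classic.

(* The eigenvalues of M listed with algebraic multiplicity: the roots of its
   characteristic polynomial, which is monic and splits over R[i]. *)
Definition eigenvalues (R : realType) (k : nat) (M : 'M[R[i]]_k) : seq R[i] :=
  sval (closed_field_poly_normal (char_poly M)).

Section Blocks.
Variables (R : realType) (n m : nat).
Variables (tau gamma theta zeta : R) (L : 'M[R]_m).

Definition alpha : R := tau / Num.sqrt gamma.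

Definition omega : R[i] := cos zeta +i* sin zeta.

Definition subdiag : 'M[R]_n := \matrix_(i, j) (i == j.+1 :> nat)%:R.

(* e_1 e_n^T: the only nonzero entry is the top-right corner. *)
Definition corner : 'M[R]_n :=
  \matrix_(i, j) ((i == 0 :> nat)%N && (j.+1 == n))%:R.

Definition B1 : 'M[R]_n := 1%:M - subdiag.
Definition B2 : 'M[R]_n := theta%:M + (1 - theta) *: subdiag.
Definition mxB : 'M[R]_n := B1 *m invmx B2.

Definition S1 : 'M[R[i]]_n := cmx B1 - omega *: cmx corner.
Definition S2 : 'M[R[i]]_n :=
  cmx B2 + (omega * (1 - theta)%:C) *: cmx corner.
Definition mxS : 'M[R[i]]_n := S1 *m invmx S2.

Definition mxT : 'M[R]_(n * m) := mxB *t 1%:M + tau *: (1%:M *t (- L)).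

Definition calA : 'M[R]_(n * m + n * m) :=
  block_mx (alpha *: (1%:M *t 1%:M)) mxT^T
           mxT (- (alpha *: (1%:M *t 1%:M))).

Definition PMS : 'M[R[i]]_(n * m + n * m) :=
  block_mx
    (sqrtmx (mxS^t* *m mxS + ((alpha ^+ 2)%:C)%:M) *t 1%:M
       + tau%:C *: (1%:M *t cmx (- L))) 0
    0 (sqrtmx (mxS *m mxS^t* + ((alpha ^+ 2)%:C)%:M) *t 1%:M
       + tau%:C *: (1%:M *t cmx (- L))).

End Blocks.

Definition in_clusters (R : realType) (z : R[i]) : bool :=
  (complex.Im z == 0) &&
  ((complex.Re z \in `[- Num.sqrt 2, - (Num.sqrt 2)^-1])
   || (complex.Re z \in `[(Num.sqrt 2)^-1, Num.sqrt 2])).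

Lemma eigenvaluesE (R : realType) (k : nat) (M : 'M[R[i]]_k) :
  char_poly M = \prod_(z <- eigenvalues M) ('X - z%:P).
Proof.
rewrite /eigenvalues; case: closed_field_poly_normal => r /= {1}->.
by rewrite (monicP (char_poly_monic M)) scale1r.
Qed.

Lemma hpsd_root_uniq (R : realType) (k : nat) (A X Y : 'M[R[i]]_k) :
  hpsd_root A X -> hpsd_root A Y -> X = Y.
Proof.
move=> [[/is_hermitianmxP hX pX] XX] [[/is_hermitianmxP hY pY] YY].
move: hX hY; rewrite expr0 !scale1r => hX hY.
set D := X - Y.
have hD : D^t* = D by rewrite /D linearB /= map_mxB -hX -hY.
have key (v : 'cV[R[i]]_k) (a : R[i]) : a^*%C = a -> D *m v = a *: v ->
    a *: v = 0.
  move=> ra Dv.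
  have vD : v^t* *m D = a *: v^t*.
    have := congr1 (fun M => M^t*) Dv; rewrite /= trmx_mul map_mxM hD => ->.
    by rewrite linearZ /= map_mxZ; congr (_ *: _).
  have [->|a0] := eqVneq a 0; first by rewrite scale0r.
  have E : a *: (v^t* *m X *m v + v^t* *m Y *m v) = 0.
    have -> : a *: (v^t* *m X *m v + v^t* *m Y *m v)
        = v^t* *m X *m (D *m v) + v^t* *m D *m Y *m v.
      by rewrite Dv vD -scalemxAr -!scalemxAl scalerDr.
    rewrite /D !(mulmxBl, mulmxBr) -!mulmxA [X *m (X *m _)]mulmxA XX.
    by rewrite [Y *m (Y *m _)]mulmxA YY addrA subrK subrr.
  move/eqP: E; rewrite scaler_eq0 (negPf a0) /= => /eqP E.
  have := congr1 (fun M : 'M[R[i]]_1 => M 0 0) E; rewrite !mxE => /eqP.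
  have := paddr_eq0 (pX v) (pY v); rewrite ![in X in X -> _]mxE => -> /andP[].
  move=> /eqP x0 /eqP y0.
  have : v^t* *m D *m v = 0.
    rewrite /D mulmxBr mulmxBl; apply/matrixP => i j.
    by rewrite !ord1 !mxE x0 y0 subrr.
  rewrite vD -scalemxAl => /eqP; rewrite scaler_eq0 (negPf a0) /= => /eqP.
  move=> /(congr1 (fun M : 'M[R[i]]_1 => M 0 0)); rewrite !mxE => /eqP.
  rewrite psumr_eq0; last by move=> i _; rewrite !mxE mulrC mul_conjC_ge0.
  move=> /allP vi0; suff -> : v = 0 by rewrite scaler0.
  apply/matrixP => i j; rewrite !ord1 !mxE.
  have := vi0 i (mem_index_enum _); rewrite !mxE /= mulrC mul_conjC_eq0.
  by move/eqP.
suff : D = 0 by move/eqP; rewrite subr_eq0 => /eqP.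
have Dh : D \is hermsymmx by apply/is_hermitianmxP; rewrite expr0 scale1r hD.
have /hermitian_spectral_diag_real/mxOverP Dr := Dh.
have Dn : D \is normalmx by apply: hermitian_normalmx.
have /orthomx_spectralP DE := Dn.
set P := spectralmx D in DE; set d := spectral_diag D in DE Dr.
have Pu : P \in unitmx by apply: spectral_unit.
suff d0 : d = 0 by rewrite DE d0 (_ : diag_mx 0 = 0) ?linear0 ?mulmx0 ?mul0mx.
have DP : D *m invmx P = invmx P *m diag_mx d.
  by rewrite {1}DE -!mulmxA mulmxV // mulmx1.
apply/rowP => j; rewrite [RHS]mxE.
have Dc : D *m col j (invmx P) = d 0 j *: col j (invmx P).
  rewrite colE mulmxA DP -!colE mul_mx_diag; apply/colP => i.
  by rewrite !mxE mulrC.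
have := key _ _ (conj_Creal (Dr 0 j)) Dc.
move/eqP; rewrite scaler_eq0 => /orP[/eqP //|/eqP c0].
have := congr1 (fun M => (P *m M) j 0) c0.
by rewrite colE mulmxA mulmxV // mul1mx mulmx0 !mxE !eqxx => /eqP; rewrite oner_eq0.
Qed.

Lemma sqrtmxP (R : realType) (k : nat) (A : 'M[R[i]]_k) :
  hpsd A -> hpsd_root A (sqrtmx A).
Proof.
move=> [Ah pA]; suff [X hX] : exists X, hpsd_root A X.
  by rewrite /sqrtmx; case: xgetP => [Y _ //|/(_ X)]; case.
have An : A \is normalmx by apply: hermitian_normalmx.
have /orthomx_spectralP AE := An.
set P := spectralmx A in AE; set d := spectral_diag A in AE.
have Pu : P \is unitarymx by apply: spectral_unitarymx.
have Pi : P \in unitmx by apply: unitarymx_unit.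
have PV : invmx P = P^t* by apply: invmx_unitary.
have dge j : 0 <= d 0 j.
  have dE : P *m A *m P^t* = diag_mx d.
    by rewrite AE !mulmxA mulmxV // mul1mx -PV mulmxK.
  have := pA ((row j P)^t*); rewrite trmxCK -row_mul.
  suff -> : (row j (P *m A) *m (row j P)^t*) 0 0 = (P *m A *m P^t*) j j.
    by rewrite dE mxE eqxx mulr1n.
  by rewrite !mxE; apply: eq_bigr => l _; rewrite !mxE.
pose X := P^t* *m diag_mx (map_mx sqrtC d) *m P.
exists X; split; first split.
- apply/is_hermitianmxP; rewrite expr0 scale1r /X !trmx_mul !map_mxM trmxCK mulmxA.
  congr (_ *m _ *m _); rewrite tr_diag_mx map_diag_mx; congr diag_mx.
  by apply/rowP => j; rewrite !mxE [RHS]conj_Creal // ger0_real // sqrtC_ge0.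
- move=> x; have -> : x^t* *m X *m x
      = (P *m x)^t* *m diag_mx (map_mx sqrtC d) *m (P *m x).
    by rewrite trmx_mul map_mxM /X !mulmxA.
  rewrite mul_mx_diag mxE sumr_ge0 // => j _; rewrite !mxE.
  rewrite mulrAC mulr_ge0 ?sqrtC_ge0 // mulrC; exact: mul_conjC_ge0.
rewrite /X -!mulmxA [P *m (P^t* *m _)]mulmxA -PV mulmxV // mul1mx.
rewrite [diag_mx _ *m (_ *m _)]mulmxA mulmx_diag [RHS]AE mulmxA.
congr (_ *m _ *m _); congr diag_mx; apply/rowP => j.
by rewrite !mxE -expr2 sqrtCK.
Qed.

(* Main.v *)
Require Import Defs.
From mathcomp Require Import all_boot all_order all_algebra.
From mathcomp Require Import all_classical all_reals all_analysis.
From mathcomp Require Import complex mxtens zify ring lra.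

(** If the time stepping were periodic up to the phase omega, that is, with S in
place of B, then all eigenvalues would lie in the clusters; S and B differ by a
matrix of rank one, and each extra rank moves boundedly many eigenvalues out.

Write Z for the subdiagonal shift closed up by the phase omega in the corner.
Z is unitary, and S = (I - Z) (theta I + (1 - theta) Z)^-1 is a rational
function of it, so S is normal: S = U^* diag(lambda) U with |z| = 1 for the
eigenvalues z of Z.  The Cayley-type map z |-> (1 - z)/(theta + (1 - theta) z)
sends the unit circle to the closed right half-plane because theta >= 1/2
([cayley_udiag]).  Diagonalize -L = V^* diag(mu) V with mu >= 0 and put
W = U (x) V.  In the basis W both diagonal blocks of the preconditioner P become
the same positive diagonal matrix p = sqrt(|lambda|^2 + alpha^2) + tau mu, and
T_S = S (x) I + tau I (x) (-L) becomes diag(lambda + tau mu).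

Let A_S be the saddle-point matrix built on T_S and M = P^(-1/2) A_S P^(-1/2).
Everything commutes, so M is Hermitian and M^2 is diagonal in the basis W, with
entries (alpha^2 + |lambda + tau mu|^2) / p^2.  As Re lambda >= 0, these lie
between 1/2 and 1 ([cluster_bounds]).

The actual matrix A is built on B instead of S, and B - S has rank at most one
([quotient_lowrank_update]): both factors of S differ from those of B by a
multiple of the corner matrix.  Hence H = P^(-1/2) A P^(-1/2), which is similar
to P^-1 A, differs from M by a matrix that factors through a space of dimension
2m.  If H had more than 2m eigenvalues with square below 1/2, some nonzero
combination v of their eigenvectors would be killed by that factor; then
v H = v M, which is too short for M^2 >= 1/2.  The same argument bounds by 2m
the number of eigenvalues with square above 1 ([lowrank_inertia]).  All other
eigenvalues are in the clusters, so 4m outliers is a uniform bound.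

Vectors are rows acting on the left, so that the rows of U are eigenvectors of
U^* diag(f) U. *)

Set Implicit Arguments.
Unset Strict Implicit.
Unset Printing Implicit Defensive.

Import Order.TTheory GRing.Theory Num.Theory.
Local Open Scope complex_scope.
Local Open Scope ring_scope.
Local Open Scope sesquilinear_scope.

(** * Kronecker products *)

Lemma tensmx11 (T : pzRingType) m n : 1%:M *t 1%:M = 1%:M :> 'M[T]_(m * n).
Proof.
apply/matrixP => i j.
case: (mxtens_indexP i) => i1 i2; case: (mxtens_indexP j) => j1 j2.
rewrite tensmxE !mxE -natrM mulnb (inj_eq (can_inj (@mxtens_indexK _ _))).
by rewrite xpair_eqE.
Qed.

Lemma tensmxDl (T : pzRingType) m n p q (A B : 'M[T]_(m, n)) (E : 'M[T]_(p, q)) :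
  (A + B) *t E = A *t E + B *t E.
Proof. by apply/matrixP => i j; rewrite !mxE mulrDl. Qed.

Section UnitaryDiagonalization.
Variable C : numClosedFieldType.

(** * Unitary diagonalization *)

Lemma adjmxM m n p (A : 'M[C]_(m, n)) (B : 'M[C]_(n, p)) :
  (A *m B)^t* = B^t* *m A^t*.
Proof. by rewrite trmx_mul map_mxM. Qed.

Lemma adjmx_block m1 m2 n1 n2 (A : 'M[C]_(m1, n1)) (B : 'M[C]_(m1, n2))
    (D : 'M[C]_(m2, n1)) (E : 'M[C]_(m2, n2)) :
  (block_mx A B D E)^t* = block_mx (A^t*) (D^t*) (B^t*) (E^t*).
Proof. by rewrite tr_block_mx map_block_mx. Qed.

Lemma tensmx_unitary m n (U : 'M[C]_m) (V : 'M[C]_n) :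
  U \is unitarymx -> V \is unitarymx -> U *t V \is unitarymx.
Proof.
move=> /unitarymxP UU /unitarymxP VV; apply/unitarymxP.
by rewrite trmx_tens map_mxT tensmx_mul UU VV tensmx11.
Qed.

(** The functional calculus of a fixed orthonormal eigenbasis: for unitary U,
f |-> udiag U f is a star-morphism, which reduces matrix identities to scalar
ones. *)
Definition udiag {n} (U : 'M[C]_n) (f : 'I_n -> C) : 'M[C]_n :=
  U^t* *m diag_mx (\row_j f j) *m U.

Section FixedBasis.
Variables (n : nat) (U : 'M[C]_n).
Hypothesis Uu : U \is unitarymx.

Let UU : U *m U^t* = 1%:M. Proof. exact/unitarymxP. Qed.
Let UtU : U^t* *m U = 1%:M. Proof. exact/mulmx1C. Qed.

Lemma eq_udiag f g : f =1 g -> udiag U f = udiag U g.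
Proof.
by move=> fg; congr (_ *m diag_mx _ *m _); apply/rowP => j; rewrite !mxE.
Qed.

Lemma udiagD f g : udiag U f + udiag U g = udiag U (fun j => f j + g j).
Proof.
rewrite /udiag -mulmxDl -mulmxDr -linearD /=.
by congr (_ *m diag_mx _ *m _); apply/rowP => j; rewrite !mxE.
Qed.

Lemma udiagZ a f : a *: udiag U f = udiag U (fun j => a * f j).
Proof.
rewrite /udiag scalemxAl scalemxAr -linearZ /=.
by congr (_ *m diag_mx _ *m _); apply/rowP => j; rewrite !mxE.
Qed.

Lemma udiag_adj f : (udiag U f)^t* = udiag U (fun j => (f j)^*).
Proof.
rewrite /udiag !adjmxM trmxCK mulmxA tr_diag_mx map_diag_mx.
by congr (_ *m diag_mx _ *m _); apply/rowP => j; rewrite !mxE.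
Qed.

Lemma udiag_scalar a : a%:M = udiag U (fun=> a).
Proof.
have -> : udiag U (fun=> a) = U^t* *m diag_mx (const_mx a) *m U.
  by congr (_ *m diag_mx _ *m _); apply/rowP => j; rewrite !mxE.
rewrite diag_const_mx.
by rewrite mul_mx_scalar -scalemxAl UtU scalemx1.
Qed.

Lemma udiagM f g : udiag U f *m udiag U g = udiag U (fun j => f j * g j).
Proof.
rewrite /udiag !mulmxA -[_ *m U *m U^t*]mulmxA UU mulmx1.
rewrite -[_ *m diag_mx _ *m diag_mx _]mulmxA mulmx_diag.
by congr (_ *m diag_mx _ *m _); apply/rowP => j; rewrite !mxE.
Qed.

Lemma mul_udiag f : U *m udiag U f = diag_mx (\row_j f j) *m U.
Proof. by rewrite /udiag !mulmxA UU mul1mx. Qed.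

Lemma udiag_unit f : udiag U f \in unitmx -> forall j, f j != 0.
Proof.
rewrite /udiag !unitmx_mul => /andP[/andP[_]].
rewrite unitmxE det_diag unitfE => /prodf_neq0 f0 _ j.
by have := f0 j isT; rewrite mxE.
Qed.

Lemma invmx_udiag f : (forall j, f j != 0) ->
  invmx (udiag U f) = udiag U (fun j => (f j)^-1).
Proof.
move=> f0.
have fV : udiag U f *m udiag U (fun j => (f j)^-1) = 1%:M.
  rewrite udiagM (udiag_scalar 1).
  by apply: eq_udiag => j; rewrite divff.
by rewrite -[LHS]mulmx1 -fV mulKmx// (mulmx1_unit fV).1.
Qed.

Lemma udiag_form f (v : 'rV[C]_n) :
  (v *m udiag U f *m v^t*) 0 0 = \sum_j f j * `|(v *m U^t*) 0 j| ^+ 2.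
Proof.
have -> : v *m udiag U f *m v^t*
    = v *m U^t* *m diag_mx (\row_j f j) *m (v *m U^t*)^t*.
  by rewrite adjmxM trmxCK !mulmxA.
rewrite mul_mx_diag mxE; apply: eq_bigr => j _.
by rewrite !mxE mulrAC [RHS]mulrC normCK.
Qed.

Lemma udiag_form_ge0 f (v : 'rV[C]_n) :
  (forall j, 0 <= f j) -> 0 <= (v *m udiag U f *m v^t*) 0 0.
Proof.
move=> f0; rewrite udiag_form sumr_ge0// => j _.
by rewrite mulr_ge0 ?exprn_ge0.
Qed.

End FixedBasis.

Lemma udiag_herm n (U : 'M[C]_n) f :
  (forall j, f j \is Num.real) -> (udiag U f)^t* = udiag U f.
Proof.
by move=> fr; rewrite udiag_adj; apply: eq_udiag => j; apply/CrealP/fr.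
Qed.

Lemma udiag_inj n (U : 'M[C]_n) f g :
  U \is unitarymx -> udiag U f = udiag U g -> f =1 g.
Proof.
move=> Uu /(congr1 (fun A => U *m A *m U^t*)); rewrite !mul_udiag//.
rewrite !mulmxtVK// => /matrixP fg j.
by have := fg j j; rewrite !mxE eqxx !mulr1n.
Qed.

Lemma udiag_sqrtM n (U : 'M[C]_n) f : U \is unitarymx ->
  udiag U (fun j => sqrtC (f j)) *m udiag U (fun j => sqrtC (f j)) = udiag U f.
Proof.
by move=> Uu; rewrite udiagM//; apply: eq_udiag => j; rewrite -expr2 sqrtCK.
Qed.

Lemma udiag_gram n (U : 'M[C]_n) f a : U \is unitarymx ->
  (udiag U f)^t* *m udiag U f + a%:M = udiag U (fun k => `|f k| ^+ 2 + a).
Proof.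
move=> Uu; rewrite udiag_adj udiagM// (udiag_scalar Uu) udiagD.
by apply: eq_udiag => k; rewrite normCKC.
Qed.

Lemma udiag_gramr n (U : 'M[C]_n) f a : U \is unitarymx ->
  udiag U f *m (udiag U f)^t* + a%:M = udiag U (fun k => `|f k| ^+ 2 + a).
Proof.
move=> Uu; rewrite udiag_adj udiagM// (udiag_scalar Uu) udiagD.
by apply: eq_udiag => k; rewrite normCK.
Qed.

Lemma normalmx_udiag n (A : 'M[C]_n) : A \is normalmx ->
  exists U f, U \is unitarymx /\ A = udiag U f.
Proof.
move=> /orthomx_spectralP AE.
exists (spectralmx A), (spectral_diag A 0); split; first exact: spectral_unitarymx.
rewrite {1}AE invmx_unitary ?spectral_unitarymx// /udiag.
by congr (_ *m diag_mx _ *m _); apply/rowP => j; rewrite mxE.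
Qed.

Lemma psd_udiag n (A : 'M[C]_n) : A^t* = A ->
  (forall v : 'rV[C]_n, 0 <= (v *m A *m v^t*) 0 0) ->
  exists U f, [/\ U \is unitarymx, forall j, 0 <= f j & A = udiag U f].
Proof.
move=> Ah A0; have [|U [f [Uu AE]]] := @normalmx_udiag _ A.
  by apply/normalmxP; rewrite Ah.
exists U, f; split=> // j; have := A0 (row j U); congr (0 <= _).
have -> : (row j U *m A *m (row j U)^t*) 0 0 = (U *m A *m U^t*) j j.
  by rewrite -row_mul !mxE; apply: eq_bigr => l _; rewrite !mxE.
by rewrite AE mul_udiag// mulmxtVK// !mxE eqxx mulr1n.
Qed.

(** With v = a + i b and A symmetric, the cross terms of the form cancel, leaving
its values at the real vectors a and b. *)
Lemma real_form_ge0 n (A : 'M[C]_n) : A^T = A ->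
    (forall a : 'rV[C]_n, (forall j, a 0 j \is Num.real) ->
       0 <= (a *m A *m a^T) 0 0) ->
  forall v : 'rV[C]_n, 0 <= (v *m A *m v^t*) 0 0.
Proof.
move=> As A0 v; pose a := map_mx (fun z => 'Re z) v.
pose b := map_mx (fun z => 'Im z) v.
have -> : v^t* = a^T - 'i *: b^T.
  apply/matrixP => i j; rewrite !mxE {1}[v j i]Crect conjC_rect ?Creal_Re ?Creal_Im//.
have {1}-> : v = a + 'i *: b by apply/rowP => j; rewrite !mxE -Crect.
have ab : b *m A *m a^T = a *m A *m b^T.
  have <- : (a *m A *m b^T)^T = b *m A *m a^T by rewrite !trmx_mul trmxK As mulmxA.
  by apply/matrixP => i j; rewrite !ord1 mxE.
have -> : (a + 'i *: b) *m A *m (a^T - 'i *: b^T)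
    = a *m A *m a^T + b *m A *m b^T.
  rewrite !(mulmxDl, mulmxBr) -!scalemxAl -!scalemxAr ab scalerA.
  by rewrite -expr2 sqrCi scaleN1r opprK addrA subrK.
rewrite mxE addr_ge0// A0// => j; rewrite mxE ?Creal_Re ?Creal_Im//.
Qed.

Lemma udiag_tens m n (U : 'M[C]_m) (V : 'M[C]_n) f g :
  udiag U f *t udiag V g
  = udiag (U *t V) (fun k => f (mxtens_unindex k).1 * g (mxtens_unindex k).2).
Proof.
rewrite /udiag -!tensmx_mul trmx_tens map_mxT; congr (_ *m _ *m _).
apply/matrixP => i j.
case: (mxtens_indexP i) => i1 i2; case: (mxtens_indexP j) => j1 j2.
rewrite tensmxE !mxE (inj_eq (can_inj (@mxtens_indexK _ _))) xpair_eqE.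
by rewrite mxtens_indexK/= mulrnAl mulrnAr -mulrnA mulnb andbC.
Qed.

Lemma udiag_kron_sum m n (U : 'M[C]_m) (V : 'M[C]_n) f mu t :
  U \is unitarymx -> V \is unitarymx ->
  udiag U f *t 1%:M + t *: (1%:M *t udiag V mu)
  = udiag (U *t V)
      (fun k => f (mxtens_unindex k).1 + t * mu (mxtens_unindex k).2).
Proof.
move=> Uu Vu; rewrite (udiag_scalar Vu) (udiag_scalar Uu) !udiag_tens.
by rewrite udiagZ udiagD; apply: eq_udiag => k; rewrite mulr1 mul1r.
Qed.

Lemma char_poly_conj n (Q A : 'M[C]_n) : Q \in unitmx ->
  char_poly (invmx Q *m A *m Q) = char_poly A.
Proof.
move=> Qu; rewrite /char_poly /char_poly_mx.
have -> : 'X%:M - map_mx polyC (invmx Q *m A *m Q) =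
    map_mx polyC (invmx Q) *m ('X%:M - map_mx polyC A) *m map_mx polyC Q.
  rewrite mulmxBr mulmxBl -!map_mxM /= mul_mx_scalar -scalemxAl -map_mxM.
  by rewrite mulVmx// map_mx1 scalemx1.
by rewrite !det_mulmx mulrAC -det_mulmx -map_mxM mulVmx// map_mx1 det1 mul1r.
Qed.

Lemma char_poly_udiag n (U : 'M[C]_n) f : U \is unitarymx ->
  char_poly (udiag U f) = \prod_j ('X - (f j)%:P).
Proof.
move=> Uu; rewrite /udiag -invmx_unitary// char_poly_conj ?unitarymx_unit//.
rewrite char_poly_trig; last by apply: diag_mx_is_trig.
by apply: eq_bigr => j _; rewrite !mxE eqxx mulr1n.
Qed.

(** * Eigenvalues of a low-rank perturbation *)

Definition sqnorm {n} (v : 'rV[C]_n) : C := \sum_j `|v 0 j| ^+ 2.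

Lemma sqnormE n (v : 'rV[C]_n) : (v *m v^t*) 0 0 = sqnorm v.
Proof. by rewrite mxE; apply: eq_bigr => j _; rewrite !mxE normCK. Qed.

Lemma sqnorm_unitary m n (w : 'rV[C]_m) (G : 'M[C]_(m, n)) :
  G \is unitarymx -> sqnorm (w *m G) = sqnorm w.
Proof. by move=> GU; rewrite -!sqnormE adjmxM mulmxA mulmxtVK. Qed.

(** The factor s lets one statement give both bounds on |d j|^2: a lower one with
s = 1 and an upper one with s = -1.  More
than r eigenvectors of H have a nonzero combination v with v X = 0; then
v H = v M, so the hypothesis on M is contradicted at v. *)
Lemma lowrank_inertia n r (H M : 'M[C]_n) (X : 'M[C]_(n, r)) (Y : 'M[C]_(r, n))
    (U : 'M[C]_n) (d : 'I_n -> C) (s b : C) :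
  U \is unitarymx -> H = udiag U d -> H = M + X *m Y ->
  (forall v : 'rV_n, b * sqnorm v <= s * sqnorm (v *m M)) ->
  (#|[pred j | (s * `|d j| ^+ 2 < b)%R]| <= r)%N.
Proof.
move=> Uu Hd HM bnd; rewrite leqNgt; apply/negP; set J := [pred j | _] => rJ.
pose f : 'I_#|J| -> 'I_n := enum_val.
have fJ l : s * `|d (f l)| ^+ 2 < b by have := enum_valP l.
pose G := rowsub f U.
have Gu : G \is unitarymx.
  apply/unitarymxP; have -> : G *m G^t* = mxsub f f (U *m U^t* ).
    by rewrite mxsub_mul; congr (_ *m _); apply/matrixP => i j; rewrite !mxE.
  rewrite (unitarymxP Uu); apply/matrixP => i j; rewrite !mxE.
  by rewrite (inj_eq enum_val_inj).
have /rowV0Pn[w /sub_kermxP wX w0] : kermx (G *m X) != 0.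
  rewrite -mxrank_eq0 mxrank_ker subn_eq0 -ltnNge.
  exact: leq_ltn_trans (rank_leq_col _) rJ.
have GH : G *m H = diag_mx (\row_l d (f l)) *m G.
  rewrite /G mul_rowsub_mx Hd mul_udiag//; apply/matrixP => i j.
  by rewrite !mul_diag_mx !mxE.
have wM : w *m G *m M = w *m diag_mx (\row_l d (f l)) *m G.
  rewrite -[RHS]mulmxA -GH HM 2!mulmxDr !mulmxA -(mulmxA w G X) wX.
  by rewrite mul0mx addr0.
(* The rows of G are orthonormal eigenvectors: lengths can be read off w. *)
have wd : sqnorm (w *m diag_mx (\row_l d (f l)))
    = \sum_l `|d (f l)| ^+ 2 * `|w 0 l| ^+ 2.
  by apply: eq_bigr => l _; rewrite mul_mx_diag !mxE normrM exprMn mulrC.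
have := bnd (w *m G); rewrite wM !(sqnorm_unitary _ Gu) wd -subr_le0.
have ge0 l : 0 <= (b - s * `|d (f l)| ^+ 2) * `|w 0 l| ^+ 2.
  by rewrite mulr_ge0 ?exprn_ge0// subr_ge0 ltW.
rewrite /sqnorm 2!mulr_sumr -sumrB => le0.
have : \sum_l (b - s * `|d (f l)| ^+ 2) * `|w 0 l| ^+ 2 == 0.
  rewrite eq_le sumr_ge0// andbT; apply: le_trans le0.
  by apply: ler_sum => l _; rewrite mulrBl -[s * _ * _]mulrA.
rewrite psumr_eq0// => /allP w00; case/eqP: w0; apply/rowP => l; rewrite mxE.
have := w00 l (mem_index_enum l); rewrite mulf_eq0 subr_eq0 gt_eqF//=.
by rewrite sqrf_eq0 normr_eq0 => /eqP.
Qed.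

(** * Preconditioned saddle-point matrices *)

Section Saddle.
Variables (N r : nat) (W : 'M[C]_N) (D p : 'I_N -> C) (a : C).
Variables (X : 'M[C]_(N, r)) (Y : 'M[C]_(r, N)).
Hypotheses (Wu : W \is unitarymx) (ar : a \is Num.real).
Hypothesis p_gt0 : forall k, 0 < p k.
Let g k := a ^+ 2 + `|D k| ^+ 2.
Hypothesis pg : forall k, p k ^+ 2 <= 2 * g k /\ g k <= p k ^+ 2.

Definition saddle (T : 'M[C]_N) : 'M[C]_(N + N) :=
  block_mx a%:M (T^t*) T (- a%:M).

Definition precond : 'M[C]_(N + N) := block_mx (udiag W p) 0 0 (udiag W p).

Let M0 : 'M[C]_(N + N) := saddle (udiag W D).

Let iq k := (sqrtC (p k))^-1.
Let Qi : 'M[C]_(N + N) := block_mx (udiag W iq) 0 0 (udiag W iq).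
Let M := Qi *m M0 *m Qi.

Let iq_real k : (iq k)^* = iq k.
Proof.
apply/CrealP; rewrite realV ger0_real// sqrtC_ge0; exact/ltW.
Qed.

Let iq2 k : iq k * iq k = (p k)^-1.
Proof. by rewrite -invfM -expr2 sqrtCK. Qed.

Let p0 k : p k != 0. Proof. by rewrite gt_eqF. Qed.

(** Qi is the inverse square root of the preconditioner. *)
Let QiQ : precond *m (Qi *m Qi) = 1%:M.
Proof.
rewrite !mulmx_block !(mul0mx, mulmx0, addr0, add0r) !udiagM//.
rewrite (_ : udiag W _ = 1%:M) ?scalar_mx_block// (udiag_scalar Wu 1).
by apply: eq_udiag => k; rewrite iq2 divff.
Qed.

Let Qi_herm : Qi^t* = Qi.
Proof.
rewrite adjmx_block !udiag_adj// !trmx0 !map_mx0.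
by congr block_mx; apply: eq_udiag.
Qed.

Let M_block : M = block_mx (udiag W (fun k => a / p k))
  (udiag W (fun k => (D k)^* / p k)) (udiag W (fun k => D k / p k))
  (udiag W (fun k => - a / p k)).
Proof.
rewrite /M /M0 /saddle !mulmx_block !(mul0mx, mulmx0, addr0, add0r).
rewrite -[- a%:M]raddfN /= !(udiag_scalar Wu) udiag_adj// !udiagM//.
by congr block_mx; apply: eq_udiag => k; rewrite mulrAC iq2 mulrC.
Qed.

(** M M^* is diagonal in the basis W, with entries g k / p k ^+ 2 in each block. *)
Let sqnormM (v : 'rV[C]_(N + N)) (s b : C) :
    (forall k, b <= s * (g k / p k ^+ 2)) ->
  b * sqnorm v <= s * sqnorm (v *m M).
Proof.
move=> bc; rewrite -!sqnormE adjmxM mulmxA -(mulmxA v) M_block.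
have pr k : (p k)^* = p k by apply/CrealP/ger0_real/ltW.
rewrite adjmx_block !udiag_adj// mulmx_block !udiagM// !udiagD.
set E := block_mx _ _ _ _.
have -> : E = block_mx (udiag W (fun k => g k / p k ^+ 2)) 0
                 0 (udiag W (fun k => g k / p k ^+ 2)).
  have -> : 0 = udiag W (fun=> 0) by rewrite -(udiag_scalar Wu) raddf0.
  have pk := p0; rewrite /E; congr block_mx; apply: eq_udiag => k;
    rewrite !rmorphM !fmorphV ?rmorphN /= ?conjCK (CrealP ar) pr /g ?normCK;
    by field; apply: pk.
rewrite -[v]hsubmxK !mul_row_block tr_row_mx map_col_mx.
rewrite !(mulmx0, addr0, add0r) !mul_row_col.
rewrite -subr_ge0.
set v1 := lsubmx v; set v2 := rsubmx v.
have key (w : 'rV[C]_N) : 0 <=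
    s * (w *m udiag W (fun k => g k / p k ^+ 2) *m w^t*) 0 0 - b * (w *m w^t*) 0 0.
  have -> : s * (w *m udiag W (fun k => g k / p k ^+ 2) *m w^t*) 0 0
     - b * (w *m w^t*) 0 0
     = (w *m udiag W (fun k => s * (g k / p k ^+ 2) - b) *m w^t*) 0 0.
    have -> : w *m w^t* = w *m udiag W (fun=> 1) *m w^t*.
      by rewrite -(udiag_scalar Wu 1) mulmx1.
    rewrite !udiag_form//.
    rewrite !mulr_sumr -sumrB; apply: eq_bigr => k _.
    by rewrite mul1r mulrA -mulrBl.
  by apply: udiag_form_ge0 => k; rewrite subr_ge0.
have := addr_ge0 (key v1) (key v2); congr (0 <= _).
rewrite !mxE; ring.
Qed.

(** The preconditioned matrix is similar to the Hermitian H = Qi A Qi = M + E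
with E of rank at most r + r, and the squares of the eigenvalues of M are the
g k / p k ^+ 2, which lie in [1/2, 1]. *)
Theorem saddle_outliers : exists d : 'I_(N + N) -> C,
  [/\ forall j, d j \is Num.real,
      char_poly (invmx precond *m saddle (udiag W D + X *m Y))
        = \prod_j ('X - (d j)%:P),
      (#|[pred j | (d j ^+ 2 < 2^-1)%R]| <= r + r)%N &
      (#|[pred j | (1 < d j ^+ 2)%R]| <= r + r)%N].
Proof.
set A := saddle (_ + _); pose H := Qi *m A *m Qi.
have AH : A^t* = A.
  rewrite adjmx_block trmxCK raddfN /= map_mxN tr_scalar_mx map_scalar_mx.
  by rewrite /= (CrealP ar).
have HH : H^t* = H by rewrite /H !adjmxM AH Qi_herm mulmxA.
have [|U [d [Uu Hd]]] := @normalmx_udiag _ H.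
  by apply/normalmxP; rewrite HH.
have dr j : d j \is Num.real.
  apply/CrealP; move: j; apply: (@udiag_inj _ U (fun j => (d j)^*) d Uu).
  by rewrite -udiag_adj// -Hd HH.
have Qiu : Qi \in unitmx.
  by have /mulmx1_unit[_] := QiQ; rewrite unitmx_mul => /andP[].
(* The perturbation of T enters both off-diagonal blocks, which doubles the
   inner dimension. *)
have HM : H = M + (Qi *m block_mx 0 (Y^t*) X 0) *m (block_mx Y 0 0 (X^t*) *m Qi).
  rewrite !mulmxA -(mulmxA Qi (block_mx _ _ _ _)) -mulmxDl -mulmxDr.
  congr (_ *m _ *m _); rewrite mulmx_block !(mul0mx, mulmx0, addr0, add0r).
  rewrite /M0 /saddle add_block_mx !addr0 /A /saddle linearD /= map_mxD.
  by rewrite (adjmxM X Y).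
have dn j : `|d j| ^+ 2 = d j ^+ 2 by rewrite real_normK.
exists d; split => //.
- rewrite -(char_poly_udiag _ Uu) -Hd /H.
  have -> : invmx precond = Qi *m Qi.
    by rewrite -[RHS](mulKmx (mulmx1_unit QiQ).1) QiQ mulmx1.
  rewrite -[RHS](@char_poly_conj _ (invmx Qi)) ?unitmx_inv// invmxK.
  by rewrite !mulmxA mulmxK.
- rewrite (eq_card (B := [pred j | (1 * `|d j| ^+ 2 < 2^-1)%R])); last first.
    by move=> j; rewrite !inE mul1r dn.
  apply: (lowrank_inertia Uu Hd HM) => v; apply: sqnormM => k.
  have [h _] := pg k.
  by rewrite mul1r ler_pdivlMr ?exprn_gt0// ler_pdivrMl.
rewrite (eq_card (B := [pred j | (-1 * `|d j| ^+ 2 < -1)%R])); last first.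
  by move=> j; rewrite !inE mulN1r dn ltrN2.
apply: (lowrank_inertia Uu Hd HM) => v; apply: sqnormM => k.
have [_ h] := pg k.
by rewrite mulN1r lerN2 ler_pdivrMr ?exprn_gt0// mul1r.
Qed.

End Saddle.

(** * Twisted circulant time stepping *)

(** The unitary Z of which the factors of S are affine functions. *)
Definition twisted_shift n (w : C) : 'M[C]_n :=
  \matrix_(i, j) ((i == j.+1 :> nat)%:R
                  + w * ((i == 0 :> nat)%N && (j.+1 == n))%:R).

(** A row holds a single entry, of modulus one, in the column given by the cyclic
predecessor. *)
Lemma twisted_shift_unitary n (w : C) : w * w^* = 1 ->
  twisted_shift n w \is unitarymx.
Proof.
case: n => [|n] w1; first by apply/unitarymxP/matrixP => -[].
pose c (i : 'I_n.+1) : C := if i == 0 :> nat then w else 1.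
pose prev (i : 'I_n.+1) : 'I_n.+1 := inord (if i == 0 :> nat then n else i.-1).
have prevE i : prev i = (if i == 0 :> nat then n else i.-1) :> nat.
  by rewrite inordK//; case: ifP => _; have := ltn_ord i; lia.
have prev_inj : injective prev.
  move=> i j /(congr1 val); rewrite /= !prevE => ij; apply/val_inj => /=.
  by move: ij; have := ltn_ord i; have := ltn_ord j; do 2![case: eqP]; lia.
have ZE i j : twisted_shift n.+1 w i j = c i * (j == prev i)%:R.
  rewrite mxE /c -val_eqE /= prevE eqSS.
  have [->|i0] := eqVneq (i : nat) 0; first by rewrite /= add0r.
  by rewrite /= mulr0 addr0 mul1r; congr (_%:R); lia.
have cc i : c i * (c i)^* = 1.
  by rewrite /c; case: ifP => _; rewrite ?w1// conjC1 mulr1.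
apply/unitarymxP/matrixP => i j; rewrite [LHS]mxE [RHS]mxE.
rewrite (bigD1 (prev i))//= big1 => [|k /negPf ki]; last first.
  by rewrite ZE ki mulr0 mul0r.
rewrite ZE 2!mxE ZE eqxx mulr1 addr0 (inj_eq prev_inj) rmorphM /= conjC_nat.
by case: eqVneq => [->|_]; rewrite ?mulr1 ?cc// !mulr0.
Qed.

(** Over the common denominator |theta + (1 - theta) z|^2, and using |z| = 1, the
numerator of lam + lam^* is (2 theta - 1) |1 - z|^2. *)
Lemma cayley_re_ge0 (theta z : C) : theta \is Num.real -> 1 <= 2 * theta ->
  z * z^* = 1 -> theta + (1 - theta) * z != 0 ->
  let lam := (1 - z) / (theta + (1 - theta) * z) in 0 <= lam + lam^*.
Proof.
move=> /CrealP thr th1 zz den0 /=; set den := theta + _ in den0 *.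
have denC : den^* = theta + (1 - theta) * z^*.
  by rewrite /den rmorphD rmorphM rmorphB rmorph1 /= thr.
have den0' : den^* != 0 by rewrite conjC_eq0.
have -> : (1 - z) / den + ((1 - z) / den)^*
   = (2 * theta - 1) * ((1 - z) * (1 - z)^*) / (den * den^*).
  rewrite rmorphM fmorphV /= rmorphB rmorph1.
  have -> : (2 * theta - 1) * ((1 - z) * (1 - z^*))
      = (1 - z) * den^* + (1 - z^*) * den.
    by rewrite denC /den; ring: zz.
  by field; rewrite den0 den0'.
by rewrite divr_ge0 ?mul_conjC_ge0// mulr_ge0 ?mul_conjC_ge0// subr_ge0.
Qed.

Lemma cayley_udiag n (Z : 'M[C]_n) (theta : C) : Z \is unitarymx ->
  theta \is Num.real -> 1 <= 2 * theta ->
  theta%:M + (1 - theta) *: Z \in unitmx ->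
  exists U lam, [/\ U \is unitarymx, forall j, 0 <= lam j + (lam j)^* &
    (1%:M - Z) *m invmx (theta%:M + (1 - theta) *: Z) = udiag U lam].
Proof.
move=> /unitarymxP ZZ thr th1.
have [|U [z [Uu ZE]]] := @normalmx_udiag _ Z.
  by apply/normalmxP; rewrite ZZ (mulmx1C ZZ).
have z1 j : z j * (z j)^* = 1.
  have := ZZ; rewrite ZE udiag_adj udiagM// (udiag_scalar Uu 1).
  by move=> /(udiag_inj Uu)/(_ j).
rewrite ZE !(udiag_scalar Uu) udiagZ udiagD => /udiag_unit den0.
exists U, (fun j => (1 - z j) / (theta + (1 - theta) * z j)); split=> //.
  by move=> j; apply: cayley_re_ge0.
rewrite invmx_udiag// -scaleN1r udiagZ udiagD udiagM//.
by apply: eq_udiag => j; rewrite mulN1r.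
Qed.

(** With s the square root and x = lam + lam^*, g = s^2 + t x + t^2 lies between
s^2 + t^2 >= (s + t)^2 / 2 and (s + t)^2, because 0 <= x <= 2 |lam| <= 2 s. *)
Lemma cluster_bounds (lam t a : C) : 0 <= t -> 0 <= a -> 0 <= lam + lam^* ->
  let p := sqrtC (`|lam| ^+ 2 + a ^+ 2) + t in
  let g := a ^+ 2 + `|lam + t| ^+ 2 in
  p ^+ 2 <= 2 * g /\ g <= p ^+ 2.
Proof.
move=> t0 a0 x0; set s := sqrtC _ => p g; rewrite {}/p {}/g.
set x := lam + lam^* in x0.
have sE : s ^+ 2 = `|lam| ^+ 2 + a ^+ 2 by rewrite sqrtCK.
have s0 : 0 <= s by rewrite sqrtC_ge0 addr_ge0 ?exprn_ge0.
have ls : `|lam| <= s.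
  by rewrite -ler_sqr ?nnegrE// sE lerDl exprn_ge0.
have xs : x <= 2 * s.
  rewrite -(ger0_norm x0); apply: le_trans (ler_normD _ _) _.
  by rewrite norm_conjC mulr_natl (mulr2n s) lerD.
have -> : a ^+ 2 + `|lam + t| ^+ 2 = s ^+ 2 + t * x + t ^+ 2.
  rewrite sE !normCK rmorphD /= (CrealP (ger0_real t0)) /x; ring.
split; rewrite -subr_ge0.
  have -> : 2 * (s ^+ 2 + t * x + t ^+ 2) - (s + t) ^+ 2
      = (s - t) ^+ 2 + 2 * (t * x) by ring.
  apply: addr_ge0; last by apply: mulr_ge0 => //; apply: mulr_ge0.
  by rewrite real_exprn_even_ge0// realB ?ger0_real.
have -> : (s + t) ^+ 2 - (s ^+ 2 + t * x + t ^+ 2) = t * (2 * s - x) by ring.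
by rewrite mulr_ge0// subr_ge0.
Qed.

(** Multiplying the difference of the two quotients by B2 + b K on the right leaves
a left multiple of K, so the difference has at most the rank of K. *)
Lemma quotient_lowrank_update n (B1 B2 K : 'M[C]_n) (a b : C) :
  B2 \in unitmx -> B2 + b *: K \in unitmx ->
  B1 *m invmx B2 = (B1 - a *: K) *m invmx (B2 + b *: K)
     + (a%:M + b *: (B1 *m invmx B2)) *m K *m invmx (B2 + b *: K).
Proof.
move=> B2u S2u; rewrite -mulmxDl; apply: (canRL (mulmxK S2u)).
rewrite mulmxDr mulmxKV// mulmxDl mul_scalar_mx -scalemxAl -scalemxAr.
by rewrite addrA subrK.
Qed.

End UnitaryDiagonalization.

(** * The discretization matrices *)

Section Discretization.
Variable R : realType.
Local Notation C := R[i].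

Lemma conj_real (x : R) : (x%:C)^* = x%:C.
Proof. by congr (_ +i* _); rewrite oppr0. Qed.

Lemma real_complex_real (x : R) : x%:C \is Num.real.
Proof. by apply/CrealP; rewrite conj_real. Qed.

Lemma conj_cmx m n (A : 'M[R]_(m, n)) : (cmx A)^t* = cmx A^T.
Proof. by apply/matrixP => i j; rewrite !mxE conj_real. Qed.

Lemma hpsd_udiag n (U : 'M[C]_n) f : (forall j, 0 <= f j) -> hpsd (udiag U f).
Proof.
move=> f0; split.
  apply/is_hermitianmxP; rewrite expr0 scale1r udiag_herm// => j.
  exact: ger0_real.
by move=> x; have := @udiag_form_ge0 _ _ U f (x^t*) f0; rewrite trmxCK.
Qed.

Lemma sqrtmx_udiag n (U : 'M[C]_n) f : U \is unitarymx ->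
  (forall j, 0 <= f j) -> sqrtmx (udiag U f) = udiag U (fun j => sqrtC (f j)).
Proof.
move=> Uu f0; apply: hpsd_root_uniq; first exact/sqrtmxP/hpsd_udiag.
split; last exact: udiag_sqrtM.
by apply: hpsd_udiag => j; rewrite sqrtC_ge0.
Qed.

Lemma spsd_udiag m (A : 'M[R]_m) : real_spsd A ->
  exists (V : 'M[C]_m) mu,
    [/\ V \is unitarymx, forall k, 0 <= mu k & cmx A = udiag V mu].
Proof.
move=> [/is_hermitianmxP]; rewrite expr0 scale1r => As Age0.
have AT : A^T = A by rewrite [RHS]As; apply/matrixP => i j; rewrite !mxE.
apply: psd_udiag; first by rewrite conj_cmx AT.
apply: real_form_ge0 => [|a ar]; first by rewrite map_trmx AT.
have -> : a = cmx (map_mx (@complex.Re R) a).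
  by apply/rowP => j; rewrite !mxE RRe_real.
set b := map_mx _ a; rewrite map_trmx -!map_mxM mxE.
by have := Age0 b^T; rewrite trmxK lecR.
Qed.

Lemma omega_unit (zeta : R) : omega zeta * (omega zeta)^* = 1.
Proof.
apply/eqP; rewrite eq_complex; apply/andP; split; apply/eqP => /=.
  by rewrite mulrN opprK -!expr2 cos2Dsin2.
by ring.
Qed.

Lemma corner_rank1 n :
  cmx (corner R n) = (\col_i (i == 0 :> nat)%:R) *m (\row_j (j.+1 == n)%:R).
Proof.
apply/matrixP => i j; rewrite !mxE big_ord1 !mxE rmorph_nat -natrM mulnb.
by [].
Qed.

Lemma B2_unit n (theta : R) : 0 < theta -> B2 n theta \in unitmx.
Proof.
move=> th; rewrite unitmxE det_trig.
  rewrite unitfE; apply/prodf_neq0 => i _; rewrite !mxE eqxx ltn_eqF//.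
  by rewrite mulr0 addr0 gt_eqF.
apply/is_trig_mxP => i j ij; rewrite !mxE -val_eqE ltn_eqF// add0r.
by rewrite ltn_eqF ?mulr0// ltnW.
Qed.

(** The same diagonalization serves S and, up to a rank-one term c r, the
lower triangular B. *)
Lemma mxS_mxB n (theta zeta : R) : 1 / 2 <= theta ->
  S2 n theta zeta \in unitmx ->
  exists (U : 'M[C]_n) lam (c : 'cV[C]_n) (r : 'rV[C]_n),
    [/\ U \is unitarymx, forall k, 0 <= lam k + (lam k)^*,
        mxS n theta zeta = udiag U lam &
        cmx (mxB n theta) = udiag U lam + c *m r].
Proof.
move=> th S2u; pose Z := twisted_shift n (omega zeta).
have ZE : Z = cmx (subdiag R n) + omega zeta *: cmx (corner R n).
  by apply/matrixP => i j; rewrite !mxE !rmorph_nat.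
have S1Z : S1 n zeta = 1%:M - Z.
  by rewrite ZE /S1 /B1 map_mxB map_mx1 opprD addrA.
have S2Z : S2 n theta zeta = theta%:C%:M + (1 - theta%:C) *: Z.
  rewrite ZE /S2 /B2 map_mxD map_scalar_mx map_mxZ scalerDr addrA scalerA.
  by rewrite !rmorphB !rmorph1 /= [_ * omega _]mulrC.
have th2 : 1 <= 2 * theta%:C.
  have -> : 2 * theta%:C = (2 * theta)%:C by rewrite rmorphM rmorph_nat.
  by rewrite -(rmorph1 (real_complex R)) lecR; lra.
have := S2u; rewrite S2Z => Su.
have [U [lam [Uu lam0 SE]]] := cayley_udiag
  (twisted_shift_unitary n (omega_unit zeta)) (real_complex_real theta) th2 Su.
have {}SE : mxS n theta zeta = udiag U lam by rewrite /mxS S1Z S2Z.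
have B2u : cmx (B2 n theta) \in unitmx by rewrite map_unitmx; apply: B2_unit; lra.
have := quotient_lowrank_update (cmx (B1 R n)) (omega zeta) B2u S2u.
rewrite -[X in _ = X + _]/(mxS n theta zeta) SE corner_rank1.
rewrite -map_invmx -map_mxM mulmxA -mulmxA => BE.
by do 4![eexists]; split; [exact: Uu| exact: lam0 | by [] | exact: BE].
Qed.

Lemma in_clusters_sqr (z : C) :
  z \is Num.real -> 2^-1 <= z ^+ 2 <= 1 -> in_clusters z.
Proof.
move=> /RRe_real <-; set x := complex.Re z.
rewrite /in_clusters /= eqxx /=.
have -> : 2^-1 = (2^-1 : R)%:C :> C by rewrite fmorphV rmorph_nat.
rewrite -rmorphXn -(rmorph1 (real_complex R)) !lecR => /andP[x1 x2].
have s2 : 1 <= Num.sqrt 2 :> R by rewrite -{1}sqrtr1 ler_sqrt ?ler1n.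
have xs : `|x| <= Num.sqrt 2.
  apply: le_trans s2; rewrite -(@ler_pXn2r _ 2)// ?nnegrE// expr1n real_normK//.
  exact: num_real.
have xi : (Num.sqrt 2)^-1 <= `|x|.
  by rewrite -sqrtr_sqr -sqrtrV// ler_sqrt// sqr_ge0.
rewrite !in_itv /=; move: xs xi; case: (ger0P x) => _ x_le x_ge.
  by rewrite x_le x_ge orbT.
by rewrite lerNl x_le lerNr x_ge.
Qed.

Variables (n m : nat).
Variables (tau gamma theta zeta : R) (L : 'M[R]_m).
Hypotheses (tau0 : 0 < tau) (gamma0 : 0 < gamma) (th : 1 / 2 <= theta).
Hypotheses (Lpsd : real_spsd (- L)) (S2u : S2 n theta zeta \in unitmx).

Lemma calA_saddle :
  cmx (calA n tau gamma theta L)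
  = saddle (alpha tau gamma)%:C (cmx (mxT n tau theta L)).
Proof.
rewrite /calA /saddle map_block_mx tensmx11 scalemx1 map_mxN.
by rewrite !map_scalar_mx conj_cmx.
Qed.

Lemma PMS_eigenvalues : exists d : 'I_(n * m + n * m) -> C,
  [/\ forall j, d j \is Num.real,
      char_poly (invmx (PMS n tau gamma theta zeta L)
                   *m cmx (calA n tau gamma theta L))
        = \prod_j ('X - (d j)%:P),
      (#|[pred j | (d j ^+ 2 < 2^-1)%R]| <= m + m)%N &
      (#|[pred j | (1 < d j ^+ 2)%R]| <= m + m)%N].
Proof.
have [U [lam [c [r [Uu lam0 SE BE]]]]] := mxS_mxB th S2u.
have [V [mu [Vu mu0 LE]]] := spsd_udiag Lpsd.
have Wu := tensmx_unitary Uu Vu.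
pose a : C := (alpha tau gamma)%:C.
have a0 : 0 < a.
  by rewrite -(rmorph0 (real_complex R)) ltcR divr_gt0// sqrtr_gt0.
have tC : 0 < tau%:C by rewrite -(rmorph0 (real_complex R)) ltcR.
pose t k := tau%:C * mu k.
have t0 k : 0 <= t k by rewrite mulr_ge0// ltW.
pose s j := sqrtC (`|lam j| ^+ 2 + a ^+ 2).
have g0 j : 0 < `|lam j| ^+ 2 + a ^+ 2.
  by rewrite ltr_wpDl ?exprn_ge0 ?exprn_gt0.
have aE : (alpha tau gamma ^+ 2)%:C = a ^+ 2 by rewrite rmorphXn.
pose D k := lam (mxtens_unindex k).1 + tau%:C * mu (mxtens_unindex k).2.
pose p k := s (mxtens_unindex k).1 + tau%:C * mu (mxtens_unindex k).2.
have PE : PMS n tau gamma theta zeta L = precond (U *t V) p.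
  rewrite /PMS /precond SE aE (udiag_gram _ _ Uu) (udiag_gramr _ _ Uu) LE.
  rewrite sqrtmx_udiag => [|//|j]; last exact/ltW.
  by rewrite udiag_kron_sum.
have TE : cmx (mxT n tau theta L)
    = udiag (U *t V) D + (c *t 1%:M) *m (r *t 1%:M).
  rewrite /mxT map_mxD map_mxT map_mxZ map_mxT !map_mx1 BE LE tensmxDl.
  by rewrite addrAC udiag_kron_sum// -[X in (c *m r) *t X]mulmx1 -tensmx_mul.
have p0 k : 0 < p k.
  by apply: ltr_pwDl; [rewrite /s sqrtC_gt0; exact: g0 | exact: t0].
have pg k : p k ^+ 2 <= 2 * (a ^+ 2 + `|D k| ^+ 2)
    /\ a ^+ 2 + `|D k| ^+ 2 <= p k ^+ 2.
  exact: cluster_bounds (t0 _) (ltW a0) (lam0 _).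
rewrite PE calA_saddle TE.
have [d [dr dE]] := saddle_outliers (c *t 1%:M) (r *t 1%:M) Wu
  (real_complex_real (alpha tau gamma)) p0 pg.
by move=> d1 d2; rewrite !mul1n in d1 d2; exists d.
Qed.

Lemma outliers_le :
  (count (fun z => ~~ in_clusters z)
     (eigenvalues (invmx (PMS n tau gamma theta zeta L)
                     *m cmx (calA n tau gamma theta L))) <= 4 * m)%N.
Proof.
have [d [dr dE d1 d2]] := PMS_eigenvalues.
have /permP-> : perm_eq (eigenvalues (invmx (PMS n tau gamma theta zeta L)
                     *m cmx (calA n tau gamma theta L))) (codom d).
  by apply: prod_XsubC_eq; rewrite -eigenvaluesE dE big_image.
rewrite count_map enumT -size_filter.
rewrite -[X in (X <= _)%N](cardE [pred j | ~~ in_clusters (d j)]).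
have -> : (4 * m)%N = (m + m + (m + m))%N by ring.
apply: leq_trans (leq_add d1 d2); rewrite -cardUI.
apply: leq_trans (leq_addr _ _).
apply: fintype.subset_leq_card; apply/fintype.subsetP => j; rewrite !inE /=.
apply: contraR; rewrite negb_or -!real_leNgt ?realX// => /andP[ge le].
by apply: in_clusters_sqr; rewrite ?ge.
Qed.

End Discretization.

Unset Implicit Arguments.

Theorem corollary3p13 (R : realType) (m : nat) (m_ge1 : (1 <= m)%N) :
  exists N : nat,
  forall (n : nat) (tau gamma theta zeta : R) (L : 'M[R]_m),
    (2 <= n)%N ->
    0 < tau -> 0 < gamma ->
    1 / 2 <= theta <= 1 ->
    0 <= zeta < 2 * pi ->
    real_spsd (- L) ->
    S2 n theta zeta \in unitmx ->
    (count (fun z => ~~ in_clusters z)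
       (eigenvalues (invmx (PMS n tau gamma theta zeta L)
                       *m cmx (calA n tau gamma theta L))) <= N)%N.
Proof.
exists (4 * m)%N => n tau gamma theta zeta L _ tau0 gamma0 /andP[th _] _ Lpsd S2u.
exact: outliers_le.
Qed.
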